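(* Let $\|\cdot\|$ be a norm on $\mathbb{R}^d$, with associated dual coordinate-$k$ norms $\|\cdot\|_{(k),\star}$, $k\in\{1,\dots,d\}$, and associated Capra coupling ¢. For any function $\varphi:\{0,1,\dots,d\}\to[-\infty,+\infty]$, the ¢-conjugate of $\varphi\circ\ell_0$ is $$(\varphi\circ\ell_0)^{¢}(y)=\sup_{j\in\{0,1,\dots,d\}}\big[\|y\|_{(j),\star}-\varphi(j)\big],\qquad\forall y\in\mathbb{R}^d,$$ with the convention $\|\cdot\|_{(0),\star}=0$.
   Context: $d\ge 1$ is an integer and $\langle\cdot,\cdot\rangle$ is the Euclidean scalar product on $\mathbb{R}^d$. For $x\in\mathbb{R}^d$, $\ell_0(x)\in\{0,\dots,d\}$ is the number of nonzero components of $x$. For $K\subset\{1,\dots,d\}$, $\mathcal{R}_K=\{x\in\mathbb{R}^d : x_j=0\ \forall j\notin K\}$, and for $y\in\mathbb{R}^d$, $y_K\in\mathcal{R}_K$ coincides with $y$ on the components in $K$ and is zero outside $K$. For $K\subset\{1,\dots,d\}$, $\|\cdot\|_{K,\star}$ is the norm on $\mathcal{R}_K$ dual to the restriction of $\|\cdot\|$ to $\mathcal{R}_K$: $\|y\|_{K,\star}=\sup\{\langle x,y\rangle : x\in\mathcal{R}_K,\ \|x\|\le 1\}$ for $y\in\mathcal{R}_K$. The dual coordinate-$k$ norm is $\|y\|_{(k),\star}=\sup_{K\subset\{1,\dots,d\},\,|K|\le k}\|y_K\|_{K,\star}$ for $y\in\mathbb{R}^d$. The Capra (constant along primal rays) coupling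 ¢ associated with $\|\cdot\|$ is the function $¢:\mathbb{R}^d\times\mathbb{R}^d\to\mathbb{R}$, $¢(x,y)=\langle x,y\rangle/\|x\|$ if $x\ne0$, and $¢(0,y)=0$. The ¢-conjugate of $f:\mathbb{R}^d\to[-\infty,+\infty]$ is $f^{¢}(y)=\sup_{x\in\mathbb{R}^d}\big(¢(x,y)+(-f(x))\big)$ for $y\in\mathbb{R}^d$, where the sum is the usual extended addition (the coupling being finite, no indeterminate form arises). *)

(* Defs.v *)
From HB Require Import structures.
From mathcomp Require Import all_boot all_order all_algebra.
From mathcomp Require Import all_classical all_reals all_analysis.

Set Implicit Arguments.
Unset Strict Implicit.
Unset Printing Implicit Defensive.

Import Order.TTheory GRing.Theory Num.Theory.

Local Open Scope classical_set_scope.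
Local Open Scope ring_scope.

(* R^d is 'rV[R]_d. The library already puts the sup norm on this type, so the
   arbitrary norm of the paper is a plain function N satisfying is_norm; the
   notation `|x| on vectors is never used here. *)
Record is_norm (R : realType) (d : nat) (N : 'rV[R]_d -> R) : Prop := IsNorm {
  is_norm_ge0 : forall x, 0 <= N x;
  is_norm_eq0 : forall x, N x = 0 -> x = 0;
  is_normZ : forall (a : R) x, N (a *: x) = `|a| * N x;
  is_normD : forall x y, N (x + y) <= N x + N y }.

Definition dotp (R : realType) (d : nat) (x y : 'rV[R]_d) : R :=
  \sum_(i < d) x 0 i * y 0 i.

Lemma card_nonzero_lt (R : realType) (d : nat) (x : 'rV[R]_d) :
  (#|[set i : 'I_d | x 0%R i != 0%R]%SET| < d.+1)%N.
Proof. by rewrite ltnS -[leqRHS]card_ord max_card. Qed.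

(* The l0 pseudonorm, with values in {0,...,d} = 'I_d.+1 *)
Definition ell0 (R : realType) (d : nat) (x : 'rV[R]_d) : 'I_d.+1 :=
  Ordinal (card_nonzero_lt x).

Definition coord_space (R : realType) (d : nat) (K : {set 'I_d}) :
    set 'rV[R]_d :=
  [set x | forall j, j \notin K -> x 0 j = 0].

Definition coord_proj (R : realType) (d : nat) (K : {set 'I_d})
    (y : 'rV[R]_d) : 'rV[R]_d :=
  \row_j (if j \in K then y 0 j else 0).

(* ||y||_{K,*}, meaningful for y in coord_space K. The supremum is that of a
   nonempty bounded set of reals when N is a norm, since all norms on R^d are
   equivalent; so the default value 0 of sup plays no role. *)
Definition dual_norm_on (R : realType) (d : nat) (N : 'rV[R]_d -> R)
    (K : {set 'I_d}) (y : 'rV[R]_d) : R :=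
  sup [set dotp x y | x in coord_space K `&` [set x | N x <= 1]].

(* ||y||_{(k),*}, including the convention that it is 0 for k = 0 *)
Definition dual_coord_norm (R : realType) (d : nat) (N : 'rV[R]_d -> R)
    (k : nat) (y : 'rV[R]_d) : R :=
  if k == 0%N then 0
  else sup [set dual_norm_on N K (coord_proj K y)
           | K in [set K : {set 'I_d} | (#|K| <= k)%N]].

Definition capra (R : realType) (d : nat) (N : 'rV[R]_d -> R)
    (x y : 'rV[R]_d) : R :=
  if x == 0 then 0 else dotp x y / N x.

(* The coupling is real-valued, so no indeterminate sum occurs. *)
Definition conjugate (R : realType) (X Y : Type) (c : X -> Y -> R)
    (f : X -> \bar R) (y : Y) : \bar R :=
  ereal_sup (range (fun x : X => ((c x y)%:E + - f x)%E)).

(* Main.v *)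
Require Import Defs.
From mathcomp Require Import all_boot all_order all_algebra.
From mathcomp Require Import all_classical all_reals all_analysis.

(** Group the vectors x in the supremum defining the conjugate by their number
    j of nonzero entries. On a group the term - phi j is constant, so it is
    enough to know the supremum of the coupling over each group, and the claim
    is that

      sup { capra N x y : ell0 x = j } = dual_coord_norm N j y.

    For j = 0 both sides vanish. For j > 0 the coupling is the scalar product
    of y with the normalised ray of x, so the left-hand side is the supremum of
    dotp x y over unit vectors with exactly j nonzero entries, while the
    right-hand side is, after undoing the projection of y, its supremum over
    vectors of the unit ball with at most j nonzero entries.

    The inequality from left to right (capra_le_dual_coord_norm) compares
    x / N x with the supremum taken on the support of x. As sup is a real-valued
    operation, this needs the scalar products with y to be bounded on the unit
    ball of N (dotp_le_norm), which is the equivalence of N with the sup norm: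
    N is continuous, hence attains a positive minimum on the compact unit sphere
    of the sup norm.

    The other inequality (dual_coord_norm_le_capra) is a density argument: a
    vector with at most j nonzero entries becomes, after an arbitrarily small
    perturbation along a fixed direction, a vector with exactly j of them
    (ell0_perturb). An upper bound m of the coupling on the group j gives
    dotp x y <= m * N x there, and this inequality, with N x replaced by 1,
    passes to the limit. *)

Local Open Scope classical_set_scope.
Local Open Scope ring_scope.

Import Order.TTheory GRing.Theory Num.Theory.
Import numFieldNormedType.Exports.

Set Implicit Arguments.
Unset Strict Implicit.
Unset Printing Implicit Defensive.

Lemma dotpDl (R : realType) (d : nat) (x z y : 'rV[R]_d) :
  dotp (x + z) y = dotp x y + dotp z y.
Proof. by rewrite -big_split /=; apply: eq_bigr => i _; rewrite mxE mulrDl. Qed.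

Lemma dotpZl (R : realType) (d : nat) (a : R) (x y : 'rV[R]_d) :
  dotp (a *: x) y = a * dotp x y.
Proof. by rewrite mulr_sumr; apply: eq_bigr => i _; rewrite mxE mulrA. Qed.

Lemma dotp_coord_proj (R : realType) (d : nat) (K : {set 'I_d})
    (x y : 'rV[R]_d) :
  coord_space K x -> dotp x (coord_proj K y) = dotp x y.
Proof.
move=> Kx; apply: eq_bigr => i _; rewrite mxE.
by case: ifPn => // /Kx ->; rewrite !mul0r.
Qed.

(** ell0 x is the cardinality of this set. *)
Definition supp (R : realType) (d : nat) (x : 'rV[R]_d) : {set 'I_d} :=
  [set i | x 0 i != 0]%SET.

Lemma coord_space_supp (R : realType) (d : nat) (x : 'rV[R]_d) :
  coord_space (supp x) x.
Proof. by move=> i; rewrite inE negbK => /eqP. Qed.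

Lemma ell0_eq0 (R : realType) (d : nat) (x : 'rV[R]_d) :
  (ell0 x == 0%N :> nat) = (x == 0).
Proof.
rewrite /ell0 /= cards_eq0; apply/eqP/eqP => [/setP x0|->].
  apply/rowP => i; rewrite mxE; have := x0 i.
  by rewrite !inE => /negbFE/eqP.
by apply/setP => i; rewrite !inE mxE eqxx.
Qed.

(** * Comparison of an arbitrary norm with the sup norm *)

Section Norm.
Variables (R : realType) (d : nat) (N : 'rV[R]_d -> R).
Hypothesis hN : is_norm N.

Lemma norm0 : N 0 = 0.
Proof. by rewrite -(scale0r 0) (is_normZ hN) normr0 mul0r. Qed.

Lemma norm_gt0 (x : 'rV[R]_d) : x != 0 -> 0 < N x.
Proof.
move=> x0; rewrite lt_neqAle (is_norm_ge0 hN) andbT eq_sym.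
by apply: contraNneq x0 => /(is_norm_eq0 hN) ->.
Qed.

Lemma entry_le_norm (x : 'rV[R]_d) i : `|x 0 i| <= `|x|.
Proof.
rewrite [leRHS]/Num.Def.normr /= mx_normrE.
by apply/bigmax_geP; right => /=; exists (0, i).
Qed.

Lemma norm_le_sup_norm :
  exists2 B, 0 <= B & forall x : 'rV[R]_d, N x <= B * `|x|.
Proof.
exists (\sum_(i < d) N 'e_i) => [|x].
  by apply: sumr_ge0 => i _; exact: is_norm_ge0.
rewrite {1}[x]row_sum_delta mulr_suml.
elim/big_ind2: _ => [|u a v b ua vb|i _].
- by rewrite norm0.
- by apply: le_trans (is_normD hN _ _) _; exact: lerD.
- rewrite (is_normZ hN) mulrC ler_wpM2l ?entry_le_norm//.
  exact: is_norm_ge0.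
Qed.

(** By the triangle inequality N is Lipschitz for the sup norm. *)
Lemma is_norm_continuous : continuous N.
Proof.
have [B B0 NB] := norm_le_sup_norm.
have NBB (u v : 'rV[R]_d) : N u - N v <= B * `|u - v|.
  rewrite lerBlDr; apply: le_trans (_ : N (u - v) + N v <= _).
    by rewrite -{1}(subrK v u); exact: is_normD.
  by rewrite lerD2r.
move=> x; apply/(@cvgrPdist_le _ _ _ (nbhs x)) => e e0.
have B1 : 0 < B + 1 by rewrite ltr_wpDl.
near=> z.
have xz : `|x - z| <= e / (B + 1).
  near: z; apply: cvgr_dist_le => //; exact: divr_gt0.
have Be : B * `|x - z| <= e.
  apply: le_trans (_ : (B + 1) * `|x - z| <= _).
    by rewrite ler_wpM2r// lerDl.
  by rewrite mulrC -ler_pdivlMr.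
rewrite ler_norml (le_trans (NBB _ _) Be) andbT lerNl opprB.
by apply: le_trans (NBB _ _) _; rewrite distrC.
Unshelve. all: by end_near. Qed.

(** The inverse of the minimum of N over the unit sphere of the sup norm is a
    suitable C. *)
Lemma sup_norm_le_norm :
  exists2 C, 0 <= C & forall x : 'rV[R]_d, `|x| <= C * N x.
Proof.
pose S := [set x : 'rV[R]_d | `|x| = 1].
have normS (x : 'rV[R]_d) : x != 0 -> S (`|x|^-1 *: x).
  move=> x0; rewrite /S /= normrZ normfV normr_id mulVf//.
  by rewrite normr_eq0.
have [[z z0]|all0] := pselect (exists z : 'rV[R]_d, z != 0); last first.
  (* In dimension 0 the sphere is empty and N has no minimum on it. *)
  exists 0 => // x; rewrite mul0r normr_le0.
  by apply/negPn/negP => x0; apply: all0; exists x.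
have Sne : S !=set0 by exists (`|z|^-1 *: z); exact: normS.
have Scompact : compact S.
  apply: bounded_closed_compact.
    by exists 1; split => // M M1 x /= ->; exact: ltW.
  apply: (@preimage_closed _ _ (fun x : 'rV[R]_d => `|x|) [set 1]).
    by move=> x _; exact: norm_continuous.
  exact: closed_eq.
have [c + cmin] := EVT_min_rV Sne Scompact
  (continuous_subspaceT is_norm_continuous).
rewrite inE => Sc.
have Nc : 0 < N c.
  by apply: norm_gt0; rewrite -normr_eq0 Sc oner_eq0.
exists (N c)^-1 => [|x]; first by rewrite invr_ge0 ltW.
have [->|x0] := eqVneq x 0; first by rewrite normr0 norm0 mulr0.
rewrite ler_pdivlMl// mulrC -ler_pdivlMl ?normr_gt0//.
rewrite -[X in X * N x]ger0_norm ?invr_ge0// -(is_normZ hN).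
by apply: cmin; rewrite inE; exact: normS.
Qed.

Lemma dotp_le_norm (y : 'rV[R]_d) :
  exists2 C, 0 <= C & forall x, dotp x y <= C * N x.
Proof.
have [C C0 xC] := sup_norm_le_norm.
exists ((\sum_(i < d) `|y 0 i|) * C) => [|x].
  by rewrite mulr_ge0// sumr_ge0.
rewrite -mulrA mulr_suml; apply: ler_sum => i _.
apply: le_trans (ler_norm _) _; rewrite normrM mulrC ler_wpM2l//.
exact: le_trans (entry_le_norm _ _) (xC x).
Qed.

(** * The dual coordinate norms as suprema over sparse unit vectors *)

Lemma dual_norm_on_le (K : {set 'I_d}) (y : 'rV[R]_d) (m : R) :
  (forall x, coord_space K x -> N x <= 1 -> dotp x y <= m) ->
  dual_norm_on N K y <= m.
Proof.
move=> le_m; apply: ge_sup => [|_ [x [Kx Nx1] <-]]; last exact: le_m.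
exists (dotp 0 y); exists 0 => //; split => [j _|]; first by rewrite mxE.
by rewrite /= norm0 ler01.
Qed.

Lemma dual_coord_norm_le (k : nat) (y : 'rV[R]_d) (m : R) : (0 < k)%N ->
  (forall (K : {set 'I_d}) x, (#|K| <= k)%N -> coord_space K x -> N x <= 1 ->
    dotp x y <= m) ->
  dual_coord_norm N k y <= m.
Proof.
rewrite /dual_coord_norm lt0n => /negbTE -> le_m.
apply: ge_sup => [|_ [K /= Kk <-]].
  pose E : {set 'I_d} := finset.set0.
  by exists (dual_norm_on N E (coord_proj E y)), E; rewrite //= cards0.
apply: dual_norm_on_le => x Kx Nx; rewrite dotp_coord_proj//.
exact: le_m Kk Kx Nx.
Qed.

(** The bound C of the scalar products on the whole unit ball does not depend on
    the coordinate subspace, so it bounds both nested suprema at once. *)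
Lemma le_dual_coord_norm (k : nat) (K : {set 'I_d}) (x y : 'rV[R]_d) :
  (0 < k)%N -> (#|K| <= k)%N -> coord_space K x -> N x <= 1 ->
  dotp x y <= dual_coord_norm N k y.
Proof.
rewrite /dual_coord_norm lt0n => /negbTE -> Kk Kx Nx.
have [C C0 dotC] := dotp_le_norm y.
have dotC1 z : N z <= 1 -> dotp z y <= C.
  by move=> Nz; apply: le_trans (dotC z) _; rewrite ler_piMr.
apply: (@le_trans _ _ (dual_norm_on N K (coord_proj K y))).
  apply: ub_le_sup; last by exists x; rewrite ?dotp_coord_proj.
  by exists C => _ [z [Kz Nz] <-]; rewrite dotp_coord_proj// dotC1.
apply: ub_le_sup; last by exists K.
exists C => _ [L _ <-]; apply: dual_norm_on_le => z Lz Nz.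
by rewrite dotp_coord_proj// dotC1.
Qed.

(** * The coupling on vectors with a prescribed number of nonzero entries *)

Lemma capra_le_dual_coord_norm (x y : 'rV[R]_d) :
  capra N x y <= dual_coord_norm N (ell0 x) y.
Proof.
rewrite /capra; have [->|x0] := eqVneq x 0.
  by rewrite /dual_coord_norm ell0_eq0 eqxx.
have Nx := norm_gt0 x0.
rewrite mulrC -dotpZl.
apply: (@le_dual_coord_norm _ (supp x)) => //.
- by rewrite lt0n ell0_eq0.
- by move=> i /coord_space_supp xi; rewrite mxE xi mulr0.
- by rewrite (is_normZ hN) normfV gtr0_norm// mulVf// gt_eqF.
Qed.

(** Take for e the indicator of j - ell0 x indices outside the support of x: no
    cancellation can occur, whatever the size of t. *)
Lemma ell0_perturb (x : 'rV[R]_d) (j : 'I_d.+1) : (ell0 x <= j)%N ->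
  exists e : 'rV[R]_d, forall t, t != 0 -> ell0 (x + t *: e) = j.
Proof.
move=> xj; have jd : (j <= d)%N by rewrite -ltnS.
have /card_geqP[s [us ss sC]] : (j - #|supp x| <= #|~: supp x|)%N.
  by rewrite [leqRHS]cardsCs finset.setCK card_ord leq_sub2r.
exists (\row_i (i \in s)%:R) => t t0.
apply/val_inj => /=.
rewrite (_ : [set _ | _]%SET = supp x :|: [set i in s])%SET; last first.
  apply/setP => i; rewrite !inE !mxE.
  case: (boolP (i \in s)) => [/sC|_]; last by rewrite mulr0 addr0 orbF.
  by rewrite !inE negbK orbT mulr1 => /eqP ->; rewrite add0r.
rewrite cardsU disjoint_setI0 ?cards0; last first.
  rewrite disjoint_subset; apply/fintype.subsetP => i xi; rewrite !inE.
  by apply/negP => /sC; rewrite inE xi.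
have -> : #|[set i in s]%SET| = (j - #|supp x|)%N.
  by rewrite -ss -(card_uniqP us); apply: eq_card => i; rewrite inE.
by rewrite subn0 subnKC.
Qed.

Lemma ell0_surj (j : 'I_d.+1) : exists x : 'rV[R]_d, ell0 x = j.
Proof.
have [|e xj] := @ell0_perturb 0 j; last first.
  by exists (0 + 1 *: e); apply: xj; exact: oner_neq0.
by have /eqP -> : ell0 (0 : 'rV[R]_d) == 0%N :> nat by rewrite ell0_eq0.
Qed.

(** Density of the vectors with exactly j nonzero entries among those with at
    most j, expressed through upper bounds of the coupling. *)
Lemma dual_coord_norm_le_capra (j : 'I_d.+1) (y : 'rV[R]_d) (m : R) :
  (forall x, ell0 x = j -> capra N x y <= m) ->
  dual_coord_norm N j y <= m.
Proof.
move=> le_m; have [j0|j_gt0] := posnP j.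
  have ell00 : ell0 (0 : 'rV[R]_d) = j.
    by apply/val_inj; rewrite [RHS]j0; apply/eqP; rewrite ell0_eq0.
  by have := le_m 0 ell00; rewrite /capra /dual_coord_norm eqxx j0.
have dot_le x : ell0 x = j -> dotp x y <= m * N x.
  move=> xj; have x0 : x != 0 by rewrite -ell0_eq0 xj -lt0n.
  by have := le_m x xj; rewrite /capra (negbTE x0) ler_pdivrMr ?norm_gt0.
have ell0Z (a : R) (x : 'rV[R]_d) : a != 0 -> ell0 (a *: x) = ell0 x.
  move=> a0; apply/val_inj => /=; congr #|pred_of_set _|.
  by apply/setP => i; rewrite !inE mxE mulf_eq0 (negbTE a0).
(* The coupling takes opposite values at x and - x. *)
have m0 : 0 <= m.
  have [x xj] := ell0_surj j.
  have x0 : x != 0 by rewrite -ell0_eq0 xj -lt0n.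
  have := dot_le _ xj; have := dot_le (- 1 *: x).
  rewrite ell0Z ?oppr_eq0 ?oner_eq0// => /(_ xj).
  rewrite dotpZl (is_normZ hN) normrN normr1 mul1r mulN1r => h1 h2.
  have := lerD h1 h2; rewrite addNr -mulrDl pmulr_lge0 ?norm_gt0//.
  by rewrite -mulr2n pmulrn_lge0.
apply: dual_coord_norm_le => // K x Kj Kx Nx.
have [|e xe] := @ell0_perturb x j.
  apply: leq_trans Kj; apply: subset_leq_card.
  apply/fintype.subsetP => i; rewrite inE; apply: contraR => /Kx ->.
  by rewrite eqxx.
apply/ler_addgt0Pr => eps eps0.
(* Along x + t *: e the bound dotp <= m * N gives
   dotp x y <= m + t * (m * N e - dotp e y); the choice of c makes the excess at
   most eps, the summand 1 only keeping c positive. *)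
pose c := `|m * N e - dotp e y| + 1.
have c0 : 0 < c by rewrite ltr_wpDl.
pose t := eps / c; have t0 : 0 < t by exact: divr_gt0.
have := dot_le _ (xe t (lt0r_neq0 t0)).
rewrite dotpDl dotpZl -lerBrDr => /le_trans; apply.
have h : N (x + t *: e) <= 1 + t * N e.
  apply: le_trans (is_normD hN _ _) _.
  by rewrite (is_normZ hN) gtr0_norm// lerD2r.
apply: le_trans (_ : m * (1 + t * N e) - t * dotp e y <= _).
  by rewrite lerD2r ler_wpM2l.
rewrite mulrDr mulr1 -addrA lerD2l mulrCA -mulrBr.
apply: le_trans (_ : t * c <= _).
  by rewrite ler_wpM2l ?ltW// (le_lt_trans (ler_norm _))// ltrDl.
by rewrite divfK ?gt_eqF.
Qed.

End Norm.

Theorem proposition4p4 (R : realType) (d : nat) (hd : (0 < d)%N)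
    (N : 'rV[R]_d -> R) (hN : is_norm N)
    (phi : 'I_d.+1 -> \bar R) (y : 'rV[R]_d) :
  conjugate (capra N) (phi \o @ell0 R d) y =
  ereal_sup (range (fun j : 'I_d.+1 =>
    ((dual_coord_norm N j y)%:E - phi j)%E)).
Proof.
apply/eqP; rewrite eq_le; apply/andP; split.
  apply: ge_ereal_sup => _ [x _ <-] /=.
  apply: le_ereal_sup_tmp.
  exists ((dual_coord_norm N (ell0 x) y)%:E - phi (ell0 x))%E.
    by exists (ell0 x).
  by apply: leeB; rewrite // lee_fin capra_le_dual_coord_norm.
apply: ge_ereal_sup => _ [j _ <-] /=.
set M := conjugate _ _ _.
have leM x : ell0 x = j -> ((capra N x y)%:E - phi j <= M)%E.
  by move=> <-; apply: ereal_sup_ubound; exists x.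
(* When phi j = -oo the term is +oo, and it is reached only because some x has
   exactly j nonzero entries. *)
have [x xj] := ell0_surj R j.
have := leM x xj.
case: (phi j) leM => [r| |] leM; last 2 first.
- by rewrite leNye.
- by [].
clearbody M; case: M leM => [m| |] leM; [|by move=> _; rewrite leey|by []].
move=> _; rewrite -EFinB lee_fin lerBlDr.
apply: (dual_coord_norm_le_capra hN) => z zj.
by have := leM z zj; rewrite -EFinB lee_fin lerBlDr.
Qed.
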